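(* Let $n\ge 1$, let $a=(a_1,\ldots,a_n)$ and $b=(b_1,\ldots,b_n)$ be two $n$-tuples of positive integers, let $X$ be a non-empty subset of $\mathbb{N}\setminus\{0\}$ and let $g$ be a positive integer. Then the problem $\mathrm{P}(a,b,X,g)$ has a solution if and only if the (possibly infinite) cardinality of $\mathbb{N}\setminus M(a,b,X)$ is greater than or equal to $g$.
   Context: $\mathbb{N}$ is the set of non-negative integers. A solution of the problem $\mathrm{P}(a,b,X,g)$ is a subset $C$ of $\mathbb{N}\setminus\{0\}$ such that: (P1) the cardinality of $C$ is equal to $g$; (P2) if $x,y\in\mathbb{N}\setminus\{0\}$ and $x+y\in C$, then $C\cap\{x,y\}\neq\emptyset$; (P3) if $x\in C$ and $\frac{x-b_i}{a_i}\in\mathbb{N}\setminus\{0\}$ for some $i\in\{1,\ldots,n\}$, then $\frac{x-b_i}{a_i}\in C$; (P4) $X\cap C=\emptyset$. A numerical semigroup is a submonoid $S$ of $(\mathbb{N},+)$ with $\mathbb{N}\setminus S$ finite. For $s\in\mathbb{N}$, $as+b=(a_1s+b_1,\ldots,a_ns+b_n)$. $\mathcal{N}(a,b,X)$ is the set of all numerical semigroups $S$ such that $X\subseteq S$ and $as+b\in S^n$ for all $s\in S\setminus\{0\}$. $M(a,b,X)=\bigcap_{S\in\mathcal{N}(a,b,X)}S$ (note that $\mathbb{N}\in\mathcal{N}(a,b,X)$). *)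

(* Defs.v *)
From mathcomp Require Import all_boot all_order all_algebra.
From mathcomp Require Import all_classical.

Set Implicit Arguments.
Unset Strict Implicit.
Unset Printing Implicit Defensive.

Import GRing.Theory.
Local Open Scope classical_set_scope.
Local Open Scope card_scope.

Definition positive_nats : set nat := [set x | 0 < x].

Definition affine_tuple (n : nat) (a b : n.-tuple nat) (s : nat) : n.-tuple nat :=
  [tuple tnth a i * s + tnth b i | i < n].

(* In [sol_affine] the quotient is taken in rat, because nat subtraction and
   division are truncated. *)
Record is_solution (n : nat) (a b : n.-tuple nat) (X : set nat) (g : nat)
    (C : set nat) : Prop := IsSolution {
  sol_sub : C `<=` positive_nats ;
  sol_card : C #= `I_g ;
  sol_split : forall x y : nat, positive_nats x -> positive_nats y ->
    C (x + y) -> C `&` [set x; y] !=set0 ;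
  sol_affine : forall (x : nat) (i : 'I_n) (q : nat), C x -> positive_nats q ->
    ((x%:R - (tnth b i)%:R) / (tnth a i)%:R = q%:R :> rat)%R -> C q ;
  sol_disj : X `&` C = set0
}.

Record numerical_semigroup (S : set nat) : Prop := NumericalSemigroup {
  nsg0 : S 0 ;
  nsgD : forall x y : nat, S x -> S y -> S (x + y) ;
  nsg_cofinite : finite_set (~` S)
}.

Definition semigroup_family (n : nat) (a b : n.-tuple nat) (X : set nat) :
    set (set nat) :=
  [set S | [/\ numerical_semigroup S, X `<=` S &
     forall s : nat, (S `\ 0) s ->
       forall i : 'I_n, S (tnth (affine_tuple a b s) i)]].

Definition family_meet (n : nat) (a b : n.-tuple nat) (X : set nat) : set nat :=
  \bigcap_(S in semigroup_family a b X) S.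

(* Main.v *)
(* Complements of solutions are exactly the members of the family of numerical
   semigroups with [g] gaps, so the gaps of any solution lie in the complement
   of the intersection [M]. Conversely [M] has all the closure properties of the
   family except possibly a finite complement; the [g] smallest non-members of
   [M] form a solution, because (P2) and (P3) only relate an element to smaller
   ones. *)
Require Import Defs.
From mathcomp Require Import all_boot all_order all_algebra.
From mathcomp Require Import all_classical.

Local Open Scope classical_set_scope.
Local Open Scope card_scope.

(* Taking the least element of [A] beyond the current segment adds exactly one. *)
Lemma initial_segment_card (A : set nat) (g : nat) :
  `I_g #<= A -> exists m, A `&` `I_m #= `I_g.
Proof.
elim: g => [_|g IHg leA]; first by exists 0; rewrite II0 setI0.
have [|m cardm] := IHg.
  by apply: card_le_trans leA; rewrite card_le_II.
(* Otherwise [A] equals its part below [m], which has only [g] elements, against the assumed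
   [g.+1]. *)
have [k [Ak lemk]] : exists k, A k /\ m <= k.
  apply: contrapT => /forallNP noA.
  have subA : A `<=` A `&` `I_m.
    by move=> x Ax; split=> //=; rewrite ltnNge; apply/negP => lemx; case: (noA x).
  have := card_le_trans leA (subset_card_le subA).
  by rewrite (card_le_eqr cardm) card_le_II ltnn.
have exP : exists k, `[<A k>] && (m <= k) by exists k; rewrite lemk andbT; apply/asboolP.
case: (ex_minnP exP) => {Ak lemk exP} {}k /andP[/asboolP Ak lemk] mink.
exists k.+1; apply/eq_cardSP; exists k; first by split=> /=.
(* By minimality of [k], nothing in [A] lies between [m] and [k]. *)
suff -> : (A `&` `I_k.+1) `\ k = A `&` `I_m by [].
apply/seteqP; split=> x /=.
  move=> [[Ax ltxk] /eqP nexk]; split=> //; rewrite ltnNge; apply/negP => lemx.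
  have /mink : `[<A x>] && (m <= x) by rewrite lemx andbT; apply/asboolP.
  by rewrite leqNgt ltn_neqAle nexk -ltnS ltxk.
move=> [Ax ltxm]; have ltxk := leq_trans ltxm lemk.
by split; [split=> //; rewrite ltnS ltnW | move=> eqxk; rewrite eqxk ltnn in ltxk].
Qed.

(** Moves (P3) from [rat] to an equation in [nat] without subtraction; [p] must be nonzero since
    division by zero returns 0. *)
Lemma affine_quotE (x p q r : nat) : 0 < p ->
  ((x%:R - r%:R) / p%:R = q%:R :> rat)%R <-> x = p * q + r.
Proof.
move=> p_gt0; have p_neq0 : (p%:R != 0 :> rat)%R.
  by rewrite Num.Theory.pnatr_eq0 -lt0n.
split=> [quotE|->]; last first.
  by rewrite GRing.natrD GRing.addrK GRing.natrM GRing.mulrC GRing.mulKf.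
apply/eqP; rewrite -(Num.Theory.eqr_nat rat) GRing.natrD GRing.natrM -quotE.
by rewrite GRing.mulrC GRing.divfK // GRing.subrK.
Qed.

(** The contrapositives of (P2) and (P3) are closure of the complement under addition and under the
    affine maps; (P1) makes [C] finite. *)
Lemma setC_solution_family (n : nat) (a b : n.-tuple nat) (X : set nat)
    (g : nat) (C : set nat) :
  (forall i : 'I_n, 0 < tnth a i) -> X `<=` positive_nats ->
  is_solution a b X g C -> semigroup_family a b X (~` C).
Proof.
move=> a_gt0 Xpos [subC cardC splitC affC disjC]; split.
- split=> [/subC //|x y nCx nCy Cxy|]; last first.
    by rewrite setCK; exists g.
  (* (P2) covers only positive summands, so a zero summand is treated apart. *)
  have [x0|x_gt0] := posnP x; first by move: Cxy; rewrite x0 add0n.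
  have [y0|y_gt0] := posnP y; first by move: Cxy; rewrite y0 addn0.
  by have [z [Cz [zE|zE]]] := splitC x y x_gt0 y_gt0 Cxy; rewrite zE in Cz.
- by move=> x Xx Cx; have : (X `&` C) x by []; rewrite disjC.
move=> s [nCs /eqP s_neq0] i; rewrite tnth_mktuple => Cas.
apply: nCs; apply: (affC _ i s Cas); last exact/affine_quotE.
by rewrite /positive_nats /= lt0n.
Qed.

Section FamilyMeet.
Variables (n : nat) (a b : n.-tuple nat) (X : set nat).
Local Notation M := (family_meet a b X).

Lemma family_meet0 : M 0.
Proof. by move=> S [[]]. Qed.

Lemma family_meetD (x y : nat) : M x -> M y -> M (x + y).
Proof. by move=> Mx My S famS; case: (famS) => -[_ SD _] _ _; apply: SD; [exact: Mx | exact: My]. Qed.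

Lemma sub_family_meet : X `<=` M.
Proof. by move=> x Xx S [_ XS _]; apply: XS. Qed.

Lemma family_meet_affine (s : nat) (i : 'I_n) :
  M s -> 0 < s -> M (tnth a i * s + tnth b i).
Proof.
move=> Ms s_gt0 S famS; case: (famS) => _ _ /(_ s) affS.
have := affS _ i; rewrite tnth_mktuple; apply; split; first exact: Ms.
by move=> /= s0; rewrite s0 in s_gt0.
Qed.

Lemma truncated_gaps_solution (m g : nat) :
  (forall i : 'I_n, 0 < tnth a i) ->
  ~` M `&` `I_m #= `I_g -> is_solution a b X g (~` M `&` `I_m).
Proof.
move=> a_gt0 cardC; split=> //.
- move=> x [nMx _]; rewrite /positive_nats /= lt0n; apply/eqP => x0.
  by apply: nMx; rewrite x0; exact: family_meet0.
(* As [M] is closed under addition, one summand is a gap; it stays below [m] because the sum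
   does. *)
- move=> x y _ _ [nMxy /= ltxym].
  have [Mx|nMx] := pselect (M x); last first.
    exists x; split; last by left.
    by split=> //=; apply: leq_ltn_trans ltxym; exact: leq_addr.
  exists y; split; last by right.
  split; first by move=> My; apply: nMxy; exact: family_meetD.
  by apply: leq_ltn_trans ltxym; exact: leq_addl.
- move=> x i q [nMx /= ltxm] q_gt0 /affine_quotE xE.
  rewrite xE // in nMx ltxm; split=> [Mq|/=].
    by apply: nMx; exact: family_meet_affine.
  (* Positivity of the coefficient gives [q <= tnth a i * q <= x < m]. *)
  by apply: leq_ltn_trans ltxm; apply: leq_trans (leq_addr _ _); rewrite leq_pmull.
by apply/seteqP; split=> // x [/sub_family_meet Mx []].
Qed.

End FamilyMeet.

Theorem theorem2p3 (n : nat) (a b : n.-tuple nat) (X : set nat) (g : nat)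
    (hn : (1 <= n)%N)
    (ha : forall i : 'I_n, (0 < tnth a i)%N)
    (hb : forall i : 'I_n, (0 < tnth b i)%N)
    (hX0 : X !=set0) (hX : X `<=` positive_nats)
    (hg : (0 < g)%N) :
  (exists C : set nat, is_solution a b X g C) <->
  `I_g #<= ~` family_meet a b X.
Proof.
split=> [[C solC]|/initial_segment_card[m cardm]]; last first.
  by exists (~` family_meet a b X `&` `I_m); exact: truncated_gaps_solution.
(* An element of [C] in the meet would lie in every member of the family, hence in the complement of
   [C]. *)
rewrite -(card_le_eql (sol_card solC)); apply: subset_card_le => x Cx Mx.
exact: (Mx _ (setC_solution_family _ _ _ _ _ _ ha hX solC)).
Qed.
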